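(* Let $\alpha=a_1\mathbf{e}_1+a_2\mathbf{e}_2\preceq\beta=b_1\mathbf{e}_1+b_2\mathbf{e}_2$ be hyperbolic numbers and let $F:[\alpha,\beta]_{\mathbf{k}}\to\mathbb{K}$ be a hyperbolic-valued function of bounded variation each of whose idempotent components depends only on the respective component of the variable, i.e. $F(x_1\mathbf{e}_1+x_2\mathbf{e}_2)=F_1(x_1)\mathbf{e}_1+F_2(x_2)\mathbf{e}_2$ with $F_1:[a_1,b_1]\to\mathbb{R}$ and $F_2:[a_2,b_2]\to\mathbb{R}$. Then the set of all points of discontinuity of $F$ is a countable union of line segments, each perpendicular to one of the two idempotent axes $\mathbb{R}\mathbf{e}_1$, $\mathbb{R}\mathbf{e}_2$.
   Context: Hyperbolic numbers: $\mathbb{K}=\{t+s\mathbf{k}: t,s\in\mathbb{R}\}$ with $\mathbf{k}^2=1$, $\mathbf{k}\notin\mathbb{R}$, a commutative ring. Put $\mathbf{e}_1=\frac{1+\mathbf{k}}{2}$, $\mathbf{e}_2=\frac{1-\mathbf{k}}{2}$; these are idempotents with $\mathbf{e}_1\mathbf{e}_2=0$, every $\alpha\in\mathbb{K}$ is uniquely $a_1\mathbf{e}_1+a_2\mathbf{e}_2$ with $a_1,a_2\in\mathbb{R}$, and operations are componentwise in this representation; $\mathbb{K}$ is identified with the plane $\mathbb{R}\mathbf{e}_1+\mathbb{R}\mathbf{e}_2$, with the idempotent axes perpendicular. Order: $\alpha\preceq\beta$ iff $a_1\le b_1$ and $a_2\le b_2$; $\alpha\prec\beta$ iff $a_1<b_1$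 and $a_2<b_2$. Interval: $[\alpha,\beta]_{\mathbf{k}}=\{\xi\in\mathbb{K}:\alpha\preceq\xi\preceq\beta\}$. Modulus: $|\alpha|_{\mathbf{k}}=|a_1|\mathbf{e}_1+|a_2|\mathbf{e}_2$. Continuity: $F$ is continuous at $\xi$ if for every $\epsilon\in\mathbb{K}$ with $0\prec\epsilon$ there is $\delta\in\mathbb{K}$ with $0\prec\delta$ such that $|\xi-\zeta|_{\mathbf{k}}\prec\delta$ ($\zeta$ in the domain) implies $|F(\xi)-F(\zeta)|_{\mathbf{k}}\prec\epsilon$. Strong partition of $[\alpha,\beta]_{\mathbf{k}}$: a finite collection of pairwise distinct points $\mathfrak{P}=\{\rho_0,\dots,\rho_n\}\subset[\alpha,\beta]_{\mathbf{k}}$ with $\alpha=\rho_0\preceq\rho_1\preceq\dots\preceq\rho_n=\beta$. Bounded variation: $F:[\alpha,\beta]_{\mathbf{k}}\to\mathbb{K}$ has bounded variation if, as $\mathfrak{P}=\{\rho_0,\dots,\rho_n\}$ ranges over all strong partitions of $[\alpha,\beta]_{\mathbf{k}}$, both the $\mathbf{e}_1$-components and the $\mathbf{e}_2$-components of the hyperbolic numbers $\sum_{j=0}^{n-1}|F(\rho_{j+1})-F(\rho_j)|_{\mathbf{k}}$ form bounded sets of real numbers. ''Countable'' allows finite or empty; if $a_1=b_1$ or $a_2=b_2$, segments may degenerate to points. *)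

(* Defs.v *)
From HB Require Import structures.
From mathcomp Require Import all_boot all_order all_algebra.
From mathcomp Require Import ring.
From mathcomp Require Import all_classical all_reals.

Set Implicit Arguments.
Unset Strict Implicit.
Unset Printing Implicit Defensive.

Import Order.TTheory GRing.Theory Num.Theory.
Local Open Scope classical_set_scope.
Local Open Scope ring_scope.

(* Hyperbolic t s stands for t + s k, where k ^ 2 = 1. *)
Record hyperbolic (R : realType) := Hyperbolic { hypt : R ; hyps : R }.

Section HyperbolicRing.
Variable R : realType.
Local Notation K := (hyperbolic R).
Implicit Types x y z : K.

Definition hyp_pair x : R * R := (hypt x, hyps x).
Definition pair_hyp (p : R * R) : K := Hyperbolic p.1 p.2.

Lemma hyp_pairK : cancel hyp_pair pair_hyp.
Proof. by case. Qed.

HB.instance Definition _ := Choice.copy (hyperbolic R) (can_type hyp_pairK).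

Definition hyp_add x y : K := Hyperbolic (hypt x + hypt y) (hyps x + hyps y).
Definition hyp_opp x : K := Hyperbolic (- hypt x) (- hyps x).
Definition hyp_mul x y : K :=
  Hyperbolic (hypt x * hypt y + hyps x * hyps y)
             (hypt x * hyps y + hyps x * hypt y).
Definition hyp_scale (a : R) x : K := Hyperbolic (a * hypt x) (a * hyps x).

Fact hyp_addA : associative hyp_add.
Proof. by move=> x y z; rewrite /hyp_add /= !addrA. Qed.
Fact hyp_addC : commutative hyp_add.
Proof. by move=> x y; congr Hyperbolic; rewrite addrC. Qed.
Fact hyp_add0 : left_id (Hyperbolic 0 0) hyp_add.
Proof. by case=> t s; rewrite /hyp_add /= !add0r. Qed.
Fact hyp_addN : left_inverse (Hyperbolic 0 0) hyp_opp hyp_add.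
Proof. by case=> t s; rewrite /hyp_add /= !addNr. Qed.

HB.instance Definition _ := GRing.isZmodule.Build (hyperbolic R)
  hyp_addA hyp_addC hyp_add0 hyp_addN.

Fact hyp_mulA : associative hyp_mul.
Proof. by move=> x y z; congr Hyperbolic => /=; ring. Qed.
Fact hyp_mulC : commutative hyp_mul.
Proof. by move=> x y; congr Hyperbolic => /=; ring. Qed.
Fact hyp_mul1 : left_id (Hyperbolic 1 0) hyp_mul.
Proof. by case=> t s; congr Hyperbolic => /=; ring. Qed.
Fact hyp_mulD : left_distributive hyp_mul (@GRing.add K).
Proof. by move=> x y z; congr Hyperbolic => /=; ring. Qed.
Fact hyp_1neq0 : Hyperbolic 1 0 != 0 :> K.
Proof. by apply/eqP => -[] /eqP; rewrite oner_eq0. Qed.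

HB.instance Definition _ := GRing.Zmodule_isComNzRing.Build (hyperbolic R)
  hyp_mulA hyp_mulC hyp_mul1 hyp_mulD hyp_1neq0.

Fact hyp_scaleA (a b : R) x : hyp_scale a (hyp_scale b x) = hyp_scale (a * b) x.
Proof. by rewrite /hyp_scale /= !mulrA. Qed.
Fact hyp_scale1 : left_id 1 hyp_scale.
Proof. by case=> t s; rewrite /hyp_scale /= !mul1r. Qed.
Fact hyp_scaleDr : right_distributive hyp_scale +%R.
Proof. by move=> a x y; congr Hyperbolic => /=; ring. Qed.
Fact hyp_scaleDl x : {morph hyp_scale^~ x : a b / a + b}.
Proof. by move=> a b; congr Hyperbolic => /=; ring. Qed.

HB.instance Definition _ := GRing.Zmodule_isLmodule.Build R (hyperbolic R)
  hyp_scaleA hyp_scale1 hyp_scaleDr hyp_scaleDl.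

End HyperbolicRing.

Section Idempotents.
Variable R : realType.
Local Notation K := (hyperbolic R).
Implicit Types x y z : K.

Definition hypk : K := Hyperbolic 0 1.
Definition e1 : K := 2%:R^-1 *: (1 + hypk).
Definition e2 : K := 2%:R^-1 *: (1 - hypk).

(* The coordinates of t + s k in the basis (e1, e2); see idemE, idem_uniq. *)
Definition idem1 x : R := hypt x + hyps x.
Definition idem2 x : R := hypt x - hyps x.

Lemma hypkk : hypk * hypk = 1.
Proof. by congr Hyperbolic => /=; ring. Qed.

Lemma e1E : e1 = Hyperbolic 2%:R^-1 2%:R^-1.
Proof. by congr Hyperbolic => /=; ring. Qed.

Lemma e2E : e2 = Hyperbolic 2%:R^-1 (- 2%:R^-1).
Proof. by congr Hyperbolic => /=; ring. Qed.

Lemma e1_idem : e1 * e1 = e1.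
Proof. by rewrite e1E; congr Hyperbolic => /=; field. Qed.

Lemma e2_idem : e2 * e2 = e2.
Proof. by rewrite e2E; congr Hyperbolic => /=; field. Qed.

Lemma e1e2 : e1 * e2 = 0.
Proof. by rewrite e1E e2E; congr Hyperbolic => /=; ring. Qed.

Lemma idemE x : x = idem1 x *: e1 + idem2 x *: e2.
Proof.
by case: x => t s; rewrite e1E e2E; congr Hyperbolic;
  rewrite /idem1 /idem2 /=; field.
Qed.

Lemma idem_uniq (a b : R) x :
  x = a *: e1 + b *: e2 -> idem1 x = a /\ idem2 x = b.
Proof. by move=> ->; rewrite e1E e2E /idem1 /idem2 /=; split; field. Qed.

Definition hyple x y : Prop := idem1 x <= idem1 y /\ idem2 x <= idem2 y.

(* Strict in both components: this is not the strict part of hyple. *)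
Definition hyplt x y : Prop := idem1 x < idem1 y /\ idem2 x < idem2 y.

Definition hypitv (alpha beta : K) : set K :=
  [set x | hyple alpha x /\ hyple x beta].

Definition hypmod x : K := `|idem1 x| *: e1 + `|idem2 x| *: e2.

(* Functions on a subset D of K are total functions of which only the values
   on D are used. *)
Definition hyp_continuous_at (D : set K) (F : K -> K) (xi : K) : Prop :=
  forall eps : K, hyplt 0 eps -> exists2 delta : K, hyplt 0 delta &
    forall zeta, D zeta -> hyplt (hypmod (xi - zeta)) delta ->
      hyplt (hypmod (F xi - F zeta)) eps.

Definition discontinuities (D : set K) (F : K -> K) : set K :=
  [set xi | D xi /\ ~ hyp_continuous_at D F xi].

(* The points of the partition are rho 0, ..., rho n. *)
Definition strong_partition (alpha beta : K) (n : nat) (rho : nat -> K) : Prop :=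
  [/\ rho 0%N = alpha, rho n = beta,
      forall j, (j <= n)%N -> hypitv alpha beta (rho j),
      forall j, (j < n)%N -> hyple (rho j) (rho j.+1) &
      forall i j, (i <= n)%N -> (j <= n)%N -> rho i = rho j -> i = j].

Definition hyp_variation (F : K -> K) (n : nat) (rho : nat -> K) : K :=
  \sum_(j < n) hypmod (F (rho j.+1) - F (rho j)).

Definition hyp_variations (alpha beta : K) (F : K -> K) : set K :=
  [set v | exists n rho,
     strong_partition alpha beta n rho /\ v = hyp_variation F n rho].

Definition bounded_reals (A : set R) : Prop := has_ubound A /\ has_lbound A.

Definition hyp_bounded_variation (alpha beta : K) (F : K -> K) : Prop :=
  bounded_reals (@idem1 @` hyp_variations alpha beta F) /\
  bounded_reals (@idem2 @` hyp_variations alpha beta F).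

Definition hypsegment (p q : K) : set K :=
  [set (1 - t) *: p + t *: q | t in [set t : R | 0 <= t <= 1]].

Definition idem_axis (e : K) : set K := [set a *: e | a in [set: R]].

(* The Euclidean inner product of the plane in which the two idempotent axes
   are the perpendicular coordinate axes. *)
Definition hypdot x y : R := idem1 x * idem1 y + idem2 x * idem2 y.

Definition perpendicular (S L : set K) : Prop :=
  forall u v w w', S u -> S v -> L w -> L w' -> hypdot (u - v) (w - w') = 0.

End Idempotents.

Arguments hypk {R}.
Arguments e1 {R}.
Arguments e2 {R}.

(* Main.v *)
Require Import Defs.
From HB Require Import structures.
From mathcomp Require Import all_boot all_order all_algebra.
From mathcomp Require Import ring lra.
From mathcomp Require Import all_classical all_reals.
From mathcomp Require Import ereal numfun realfun.

Set Implicit Arguments.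
Unset Strict Implicit.
Unset Printing Implicit Defensive.

Import Order.TTheory GRing.Theory Num.Theory.
Local Open Scope classical_set_scope.
Local Open Scope ring_scope.

(** Continuity of [F] at a point decouples into continuity of [F1] and of [F2]
    at the coordinates. Pulling a partition of one side of the rectangle back
    to its diagonal gives a strong partition, so both components have bounded
    variation. The total variation function [V] of such a component jumps
    wherever the component is discontinuous, and the jump intervals of [V] are
    disjoint, so each contains its own rational number: the discontinuities of
    each component are countable. Each of them carries one full segment of the
    rectangle. *)

(** * Discontinuities of a real function of bounded variation *)

Section RealDiscontinuities.
Variable R : realType.
Implicit Types (a b : R) (f : R -> R).

(** Continuity relative to [[a, b]], hence one-sided at the endpoints, matching the restriction of
    [zeta] to the domain in [hyp_continuous_at]. *)
Definition itv_continuous_at a b f x : Prop :=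
  forall e, 0 < e -> exists2 d, 0 < d &
    forall y, a <= y <= b -> `|x - y| < d -> `|f x - f y| < e.

Definition itv_discontinuities a b f : set R :=
  [set x | a <= x <= b /\ ~ itv_continuous_at a b f x].

Lemma countable_separated_itv (A : set R) (lo hi : R -> R) :
  (forall x, A x -> lo x < hi x) ->
  (forall x y, A x -> A y -> x < y -> hi x <= lo y) -> countable A.
Proof.
move=> lohi sep.
(* A rational strictly inside each interval: neighbouring intervals may share an endpoint. Off [A]
   the value [0] is a mere default. *)
have /choice[q qP] : forall x, exists q : rat, A x -> lo x < ratr q < hi x.
  move=> x; have [Ax|nAx] := pselect (A x); last by exists 0.
  by have [q] := rat_in_itvoo (lohi _ Ax); rewrite in_itv/= => qx; exists q.
apply/countable_injP; exists (pickle \o q) => x y.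
rewrite !inE => Ax Ay /= /(pcan_inj pickleK) qxy.
have [lox xhi] := andP (qP x Ax); have [loy yhi] := andP (qP y Ay).
rewrite qxy in lox xhi.
case: (ltgtP x y) => // xy.
- by have := lt_le_trans xhi (sep _ _ Ax Ay xy); rewrite ltNge (ltW loy).
- by have := lt_le_trans yhi (sep _ _ Ay Ax xy); rewrite ltNge (ltW lox).
Qed.

(** By additivity the right-hand side is the total variation on [[x, y]], which dominates the
    increment; bounded variation makes every term finite, so [fine] loses nothing. *)
Lemma norm_sub_le_total_variation a b f x y : bounded_variation a b f ->
  a <= x -> x <= y -> y <= b ->
  `|f y - f x| <= fine (total_variation a y f) - fine (total_variation a x f).
Proof.
move=> BVf ax xy yb.
have ay := le_trans ax xy; have xb := le_trans xy yb.
have BVay := bounded_variationl ay yb BVf.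
have finx : total_variation a x f \is a fin_num.
  exact/(bounded_variationP f ax)/(bounded_variationl ax xb).
have finxy : total_variation x y f \is a fin_num.
  exact/(bounded_variationP f xy)/(bounded_variationr ax xy).
rewrite (total_variationD f ax xy) fineD// addrAC subrr add0r.
by rewrite -lee_fin fineK// total_variation_ge.
Qed.

(** If neither side jumps by [e], some [y1 > x] and [y2 < x] have [V] within [e] of [V x], and [V]
    controls [f] between them. At an endpoint of the interval one alternative holds vacuously. *)
Lemma itv_discontinuities_jump a b f (V : R -> R) x :
  (forall y z, a <= y -> y <= z -> z <= b -> `|f z - f y| <= V z - V y) ->
  itv_discontinuities a b f x ->
  exists2 e, 0 < e & (forall y, x < y -> y <= b -> V x + e <= V y) \/
                     (forall y, a <= y -> y < x -> V y <= V x - e).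
Proof.
move=> fV [/andP[ax xb]]; apply: contra_notP => nojump e e0.
have {nojump}/not_orP[] := (fun H => nojump (ex_intro2 _ _ e e0 H)).
move=> /existsNP[y1 /not_implyP[xy1 /not_implyP[y1b /negP]]].
rewrite -ltNge => Vy1.
move=> /existsNP[y2 /not_implyP[ay2 /not_implyP[y2x /negP]]].
rewrite -ltNge => Vy2.
exists (Num.min (y1 - x) (x - y2)); first by rewrite lt_min !subr_gt0 xy1.
move=> y /andP[ay yb]; rewrite lt_min => /andP[xy_lt yx_lt].
rewrite ltr_norml in xy_lt; rewrite ltr_norml in yx_lt.
move/andP: xy_lt => [h1 h2]; move/andP: yx_lt => [h3 h4].
have [xy|/ltW yx] := leP x y.
  (* Nonnegativity of the norm makes [V] monotone, so [V y <= V y1 < V x + e]. *)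
  have yy1 : y <= y1 by lra.
  rewrite distrC; apply: le_lt_trans (fV _ _ ax xy yb) _.
  have := fV _ _ ay yy1 y1b; have := normr_ge0 (f y1 - f y); lra.
have y2y : y2 <= y by lra.
apply: le_lt_trans (fV _ _ ay yx xb) _.
have := fV _ _ ay2 y2y yb; have := normr_ge0 (f y - f y2); lra.
Qed.

Lemma bounded_variation_discontinuities_countable a b f :
  bounded_variation a b f -> countable (itv_discontinuities a b f).
Proof.
move=> BVf; set V := fun x => fine (total_variation a x f).
(* Right jumps ([A1]) and left jumps ([A2]) are counted separately, so that each point carries a
   single interval. *)
pose A1 := [set x | a <= x <= b /\
  exists2 e, 0 < e & forall y, x < y -> y <= b -> V x + e <= V y].
pose A2 := [set x | a <= x <= b /\
  exists2 e, 0 < e & forall y, a <= y -> y < x -> V y <= V x - e].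
have cA1 : countable A1.
  have /choice[e eP] : forall x, exists e, A1 x -> 0 < e /\
      forall y, x < y -> y <= b -> V x + e <= V y.
    move=> x; have [[_ [e e0 ee]]|nAx] := pselect (A1 x); last by exists 0.
    by exists e.
  apply: (@countable_separated_itv _ V (fun x => V x + e x)) => [x /eP[? _]|].
    by rewrite ltrDl.
  by move=> x y /eP[_ h] [/andP[_ yb] _] xy; exact: h.
have cA2 : countable A2.
  have /choice[e eP] : forall x, exists e, A2 x -> 0 < e /\
      forall y, a <= y -> y < x -> V y <= V x - e.
    move=> x; have [[_ [e e0 ee]]|nAx] := pselect (A2 x); last by exists 0.
    by exists e.
  (* For [x < y] the jump at the later point [y] now separates the intervals; for right jumps it was
     the one at [x]. *)
  apply: (@countable_separated_itv _ (fun x => V x - e x) V) => [x /eP[? _]|].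
    by rewrite ltrBlDr ltrDl.
  by move=> x y [/andP[ax _] _] /eP[_ h] xy; exact: h.
have : countable (\bigcup_(i in [set: bool]) if i then A1 else A2).
  by apply: bigcup_countable => // -[] _.
apply/sub_countable/subset_card_le => x dx.
have [axb _] := dx.
have [e e0 [h|h]] := itv_discontinuities_jump
  (fun y z => @norm_sub_le_total_variation a b f y z BVf) dx.
- by exists true => //; split=> //; exists e.
- by exists false => //; split=> //; exists e.
Qed.

End RealDiscontinuities.

(** * Idempotent coordinates as linear forms *)

Section HyperbolicCoordinates.
Variable R : realType.
Local Notation K := (hyperbolic R).
Implicit Types (x y z alpha beta : K) (F : K -> K).

(** With both coordinates registered as linear forms, one lemma about a generic [c : {scalar K}]
    serves for each of them. *)
Fact idem1_linear : linear_for *%R (@idem1 R).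
Proof. by move=> a [t s] [t' s']; rewrite /idem1 /=; ring. Qed.
HB.instance Definition _ :=
  GRing.isLinear.Build R K R *%R (@idem1 R) idem1_linear.

Fact idem2_linear : linear_for *%R (@idem2 R).
Proof. by move=> a [t s] [t' s']; rewrite /idem2 /=; ring. Qed.
HB.instance Definition _ :=
  GRing.isLinear.Build R K R *%R (@idem2 R) idem2_linear.

Lemma idem1E (a b : R) : idem1 (a *: e1 + b *: e2) = a.
Proof. by have [] := idem_uniq (erefl (a *: e1 + b *: e2)). Qed.

Lemma idem2E (a b : R) : idem2 (a *: e1 + b *: e2) = b.
Proof. by have [] := idem_uniq (erefl (a *: e1 + b *: e2)). Qed.

Lemma hyp_eqP x y : idem1 x = idem1 y -> idem2 x = idem2 y -> x = y.
Proof. by move=> h1 h2; rewrite (idemE x) (idemE y) h1 h2. Qed.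

Lemma idem1_mod x : idem1 (hypmod x) = `|idem1 x|.
Proof. exact: idem1E. Qed.

Lemma idem2_mod x : idem2 (hypmod x) = `|idem2 x|.
Proof. exact: idem2E. Qed.

(** * The diagonal of the rectangle and bounded variation of the components *)

Lemma scalar_line (c : {scalar K}) x y (t : R) :
  c (x + t *: (y - x)) = c x + t * (c y - c x).
Proof. by rewrite linearD linearZ/= [c (y - x)]linearB. Qed.

Lemma scalar_segment (c : {scalar K}) x y (s t : R) :
  c (s *: x + t *: y) = s * c x + t * c y.
Proof. by rewrite linearD !linearZ. Qed.

(** Both coordinates are affine in the parameter with nonnegative slope, which gives the order and
    the bounds. The points stay distinct even when one side is degenerate, because [beta - alpha] is
    nonzero. *)
Lemma diagonal_strong_partition alpha beta (n : nat) (t : nat -> R) :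
  hyple alpha beta -> alpha <> beta -> t 0%N = 0 -> t n = 1 ->
  (forall j, (j < n)%N -> t j < t j.+1) ->
  strong_partition alpha beta n (fun j => alpha + t j *: (beta - alpha)).
Proof.
move=> [le1 le2] neq t0 tn tS.
have tinc i j : (i < j <= n)%N -> t i < t j.
  elim: j => // j IH; rewrite ltnS => /andP[].
  rewrite leq_eqVlt => /predU1P[-> /tS//|ij jn].
  by rewrite (lt_trans _ (tS _ jn))// IH// ij ltnW.
have t_ge0 j : (j <= n)%N -> 0 <= t j.
  by case: j => [|j] jn; rewrite ?t0// -t0 ltW// tinc.
have t_le1 j : (j <= n)%N -> t j <= 1.
  by rewrite leq_eqVlt => /predU1P[->|jn]; rewrite -tn// ltW// tinc// jn /=.
split.
- by rewrite t0 scale0r addr0.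
- by rewrite tn scale1r addrC subrK.
- move=> j jn; have := t_ge0 j jn; have := t_le1 j jn.
  by split; split; rewrite scalar_line/=; nra.
- move=> j /tS tj.
  by split; rewrite !scalar_line/=; nra.
- move=> i j ilen jn /addrI /eqP; rewrite -subr_eq0 -scalerBl scaler_eq0.
  rewrite !subr_eq0 => /orP[/eqP tij|/eqP/esym//].
  case: (ltngtP i j) => // ij; exfalso.
  - by have := tinc i j; rewrite ij jn tij ltxx => /(_ isT).
  - by have := tinc j i; rewrite ij ilen tij ltxx => /(_ isT).
Qed.

(** The variation of [f] along a partition of the side equals the [c]-component of the variation of
    [F] along the corresponding diagonal points, so the bound [M] carries over. A degenerate side is
    split off because the parameters divide by its length. *)
Lemma bounded_variation_component alpha beta F (c : {scalar K}) (f : R -> R) :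
  hyple alpha beta -> c alpha <= c beta ->
  (forall x, c (hypmod x) = `|c x|) ->
  (forall x, hypitv alpha beta x -> c (F x) = f (c x)) ->
  has_ubound (c @` hyp_variations alpha beta F) ->
  bounded_variation (c alpha) (c beta) f.
Proof.
move=> leab; rewrite le_eqVlt => /predU1P[->|cab] cmod cF [M ubM].
  exact: bounded_variationxx.
exists M => _ [s abs <-]; apply: ubM => /=.
(* The list [s] omits the left endpoint, so it is prepended; [t] then rescales the side to
   [[0, 1]]. *)
set p := nth (c beta) (c alpha :: s).
pose t j := (p j - c alpha) / (c beta - c alpha).
have cab0 : c beta - c alpha != 0 by rewrite subr_eq0 gt_eqF.
have part : strong_partition alpha beta (size s)
    (fun j => alpha + t j *: (beta - alpha)).
  apply: diagonal_strong_partition => //.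
  - by move=> ab; rewrite ab ltxx in cab.
  - by rewrite /t /p/= subrr mul0r.
  - by rewrite /t /p (itv_partition_nth_size _ abs) divff.
  - move=> j js; rewrite ltr_pM2r ?invr_gt0 ?subr_gt0// ltrD2r.
    by have [/pathP + _] := abs; exact.
have crho j : c (alpha + t j *: (beta - alpha)) = p j.
  by rewrite scalar_line divfK// addrC subrK.
exists (hyp_variation F (size s) (fun j => alpha + t j *: (beta - alpha))).
  by exists (size s), (fun j => alpha + t j *: (beta - alpha)).
rewrite /hyp_variation /variation big_mkord linear_sum/=.
have [_ _ inD _ _] := part.
apply: eq_bigr => j _; rewrite cmod linearB/= !cF ?crho//; apply: inD.
- exact: ltnW.
- exact: ltn_ord.
Qed.

(** * The rectangle and continuity in coordinates *)

Lemma idem_box alpha beta (x1 x2 : R) :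
  hypitv alpha beta (x1 *: e1 + x2 *: e2) <->
  idem1 alpha <= x1 <= idem1 beta /\ idem2 alpha <= x2 <= idem2 beta.
Proof.
rewrite /hypitv /hyple/= idem1E idem2E.
by split=> [[[-> ->] [-> ->]]//|[/andP[? ?] /andP[? ?]]].
Qed.

Lemma hypitvP alpha beta x : hypitv alpha beta x <->
  idem1 alpha <= idem1 x <= idem1 beta /\ idem2 alpha <= idem2 x <= idem2 beta.
Proof. by rewrite {1}(idemE x); exact: idem_box. Qed.

Lemma hyp_continuous_at_split alpha beta F (F1 F2 : R -> R) x :
  (forall y, hypitv alpha beta y -> idem1 (F y) = F1 (idem1 y)) ->
  (forall y, hypitv alpha beta y -> idem2 (F y) = F2 (idem2 y)) ->
  hypitv alpha beta x ->
  hyp_continuous_at (hypitv alpha beta) F x <->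
  itv_continuous_at (idem1 alpha) (idem1 beta) F1 (idem1 x) /\
  itv_continuous_at (idem2 alpha) (idem2 beta) F2 (idem2 x).
Proof.
move=> FE1 FE2 Dx; have [Dx1 Dx2] := (hypitvP alpha beta x).1 Dx.
split=> [cF|[c1 c2] eps [eps1 eps2]]; last first.
  rewrite linear0 in eps1; rewrite linear0 in eps2.
  have [d1 d1_gt0 d1P] := c1 _ eps1; have [d2 d2_gt0 d2P] := c2 _ eps2.
  exists (d1 *: e1 + d2 *: e2).
    by split; rewrite linear0 ?idem1E ?idem2E.
  move=> z Dz []; have [Dz1 Dz2] := (hypitvP alpha beta z).1 Dz.
  rewrite idem1_mod idem2_mod idem1E idem2E !linearB/= => xz1 xz2.
  split; rewrite ?idem1_mod ?idem2_mod linearB/= ?FE1 ?FE2//.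
  - exact: d1P.
  - exact: d2P.
split=> e e_gt0.
(* [hyplt] demands positivity in both components, so [e] is placed in each. *)
- have [|d [d1 d2] dP] := cF (e *: e1 + e *: e2).
    by split; rewrite linear0 ?idem1E ?idem2E.
  rewrite linear0 in d1; rewrite linear0 in d2.
  exists (idem1 d) => // y Dy xy.
  (* The test point keeps the second coordinate of [x]: it stays in the rectangle, and its second
     distance to [x] is 0, below any admissible [delta]. *)
  have Dz : hypitv alpha beta (y *: e1 + idem2 x *: e2) by exact/idem_box.
  have [|+ _] := dP _ Dz.
    split; rewrite ?idem1_mod ?idem2_mod linearB/= ?idem1E//.
    by rewrite idem2E subrr normr0.
  by rewrite idem1_mod linearB/= FE1// FE1// !idem1E.
- have [|d [d1 d2] dP] := cF (e *: e1 + e *: e2).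
    by split; rewrite linear0 ?idem1E ?idem2E.
  rewrite linear0 in d1; rewrite linear0 in d2.
  exists (idem2 d) => // y Dy xy.
  have Dz : hypitv alpha beta (idem1 x *: e1 + y *: e2) by exact/idem_box.
  have [|_ +] := dP _ Dz.
    split; rewrite ?idem1_mod ?idem2_mod linearB/= ?idem2E//.
    by rewrite idem1E subrr normr0.
  by rewrite idem2_mod linearB/= FE2// FE2// !idem2E.
Qed.

(** * Segments parallel to the axes and perpendicularity *)

Lemma convex_param (a b y : R) : a <= y <= b ->
  exists2 t, 0 <= t <= 1 & (1 - t) * a + t * b = y.
Proof.
move=> /andP[ay yb]; have [ab|ba] := ltP a b; last first.
  (* Here [b <= a] forces [a = y = b]. *)
  by exists 0; [rewrite lexx ler01 | lra].
exists ((y - a) / (b - a)); last by field; rewrite subr_eq0 gt_eqF.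
by rewrite divr_ge0 ?subr_ge0 ?(ltW ab)//= ler_pdivrMr ?subr_gt0// mul1r lerD2r.
Qed.

Lemma hypsegment_vertical (c a b : R) : a <= b ->
  hypsegment (c *: e1 + a *: e2) (c *: e1 + b *: e2) =
  [set x : K | idem1 x = c /\ a <= idem2 x <= b].
Proof.
move=> ab; apply/seteqP; split=> [_ [t /= /andP[t0 t1] <-]|x /= [x1 x2]].
  rewrite [idem1 _]scalar_segment [idem2 _]scalar_segment/= !idem1E !idem2E.
  by split; [ring | apply/andP; split; nra].
have [t t01 tx] := convex_param x2; exists t => //.
by apply: hyp_eqP; rewrite scalar_segment/= ?idem1E ?idem2E// x1; ring.
Qed.

Lemma hypsegment_horizontal (c a b : R) : a <= b ->
  hypsegment (a *: e1 + c *: e2) (b *: e1 + c *: e2) =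
  [set x : K | idem2 x = c /\ a <= idem1 x <= b].
Proof.
move=> ab; apply/seteqP; split=> [_ [t /= /andP[t0 t1] <-]|x /= [x1 x2]].
  rewrite [idem1 _]scalar_segment [idem2 _]scalar_segment/= !idem1E !idem2E.
  by split; [ring | apply/andP; split; nra].
have [t t01 tx] := convex_param x2; exists t => //.
by apply: hyp_eqP; rewrite scalar_segment/= ?idem1E ?idem2E// x1; ring.
Qed.

(** Differences of points of [S] have no [e1]-component, while those of points of the axis have no
    [e2]-component. *)
Lemma perpendicular_e1 (S : set K) (c : R) :
  (forall x, S x -> idem1 x = c) -> perpendicular S (idem_axis e1).
Proof.
move=> Sc u v _ _ Su Sv [a _ <-] [b _ <-]; rewrite /hypdot.
have e1_2 : idem2 (@e1 R) = 0 by rewrite e1E /idem2/= subrr.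
rewrite [idem1 (u - v)]linearB/= (Sc u)// (Sc v)// subrr mul0r add0r.
by rewrite -scalerBl [idem2 (_ *: _)]linearZ/= e1_2 !mulr0.
Qed.

Lemma perpendicular_e2 (S : set K) (c : R) :
  (forall x, S x -> idem2 x = c) -> perpendicular S (idem_axis e2).
Proof.
move=> Sc u v _ _ Su Sv [a _ <-] [b _ <-]; rewrite /hypdot.
have e2_1 : idem1 (@e2 R) = 0 by rewrite e2E /idem1/= subrr.
rewrite [idem2 (u - v)]linearB/= (Sc u)// (Sc v)// subrr mul0r addr0.
by rewrite -scalerBl [idem1 (_ *: _)]linearZ/= e2_1 !mulr0.
Qed.

End HyperbolicCoordinates.

(** * The discontinuity set as a union of segments *)

Theorem lemma4p6 (R : realType) (alpha beta : hyperbolic R)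
    (F : hyperbolic R -> hyperbolic R) (F1 F2 : R -> R)
    (le_alpha_beta : hyple alpha beta)
    (FE : forall x1 x2 : R,
       idem1 alpha <= x1 <= idem1 beta -> idem2 alpha <= x2 <= idem2 beta ->
       F (x1 *: e1 + x2 *: e2) = F1 x1 *: e1 + F2 x2 *: e2)
    (BVF : hyp_bounded_variation alpha beta F) :
  exists segs : set (set (hyperbolic R)),
    [/\ countable segs,
        forall S, segs S ->
          (exists p q : hyperbolic R,
             S = hypsegment p q /\
             (p = q -> idem1 alpha = idem1 beta \/ idem2 alpha = idem2 beta)) /\
          (perpendicular S (idem_axis e1) \/ perpendicular S (idem_axis e2)) &
        discontinuities (hypitv alpha beta) F = \bigcup_(S in segs) S].
Proof.
have [le1 le2] := le_alpha_beta.
have FEx x : hypitv alpha beta x ->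
    F x = F1 (idem1 x) *: e1 + F2 (idem2 x) *: e2.
  by move=> /hypitvP[x1 x2]; rewrite {1}(idemE x) FE.
have FE1 x : hypitv alpha beta x -> idem1 (F x) = F1 (idem1 x).
  by move=> /FEx ->; rewrite idem1E.
have FE2 x : hypitv alpha beta x -> idem2 (F x) = F2 (idem2 x).
  by move=> /FEx ->; rewrite idem2E.
have [[ub1 _] [ub2 _]] := BVF.
set D1 := itv_discontinuities (idem1 alpha) (idem1 beta) F1.
set D2 := itv_discontinuities (idem2 alpha) (idem2 beta) F2.
have cD1 : countable D1.
  apply: bounded_variation_discontinuities_countable.
  exact: (@bounded_variation_component _ _ _ F (@idem1 R) _ _ _ (@idem1_mod R)).
have cD2 : countable D2.
  apply: bounded_variation_discontinuities_countable.
  exact: (@bounded_variation_component _ _ _ F (@idem2 R) _ _ _ (@idem2_mod R)).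
(* The full fibre of the rectangle over first coordinate [c]; [seg2] is the fibre over a second
   coordinate. *)
pose seg1 c := hypsegment (c *: e1 + idem2 alpha *: e2)
                          (c *: e1 + idem2 beta *: e2).
pose seg2 c := hypsegment (idem1 alpha *: e1 + c *: e2)
                          (idem1 beta *: e1 + c *: e2).
exists (\bigcup_(i in [set: bool]) if i then seg1 @` D1 else seg2 @` D2); split.
- apply: bigcup_countable => // -[] _.
  + exact: sub_countable (card_image_le _ _) cD1.
  + exact: sub_countable (card_image_le _ _) cD2.
- move=> _ [[] _ [c Dc <-]]; split.
  + exists (c *: e1 + idem2 alpha *: e2), (c *: e1 + idem2 beta *: e2).
    (* Equal endpoints have equal second coordinates, so that side of the rectangle is
       degenerate. *)
    by split=> // /(congr1 (@idem2 R)); rewrite !idem2E; right.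
  + left; apply: (@perpendicular_e1 _ _ c) => x.
    by rewrite /seg1 hypsegment_vertical// => -[].
  + exists (idem1 alpha *: e1 + c *: e2), (idem1 beta *: e1 + c *: e2).
    by split=> // /(congr1 (@idem1 R)); rewrite !idem1E; left.
  + right; apply: (@perpendicular_e2 _ _ c) => x.
    by rewrite /seg2 hypsegment_horizontal// => -[].
apply/seteqP; split=> [x [Dx ncx]|x [_ [[] _ [c [cab ncc] <-]]]].
- have [x1 x2] := (hypitvP alpha beta x).1 Dx.
  have [c1|nc1] :=
    pselect (itv_continuous_at (idem1 alpha) (idem1 beta) F1 (idem1 x)).
    have nc2 : ~ itv_continuous_at (idem2 alpha) (idem2 beta) F2 (idem2 x).
      by move=> c2; apply: ncx; exact/(hyp_continuous_at_split FE1 FE2 Dx).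
    exists (seg2 (idem2 x)); last by rewrite /seg2 hypsegment_horizontal.
    by exists false => //; exists (idem2 x).
  exists (seg1 (idem1 x)); last by rewrite /seg1 hypsegment_vertical.
  by exists true => //; exists (idem1 x).
(* Conversely, failure of continuity of [F1] at [c] does not involve the second coordinate, so it
   spoils every point of the fibre. *)
- rewrite /seg1 hypsegment_vertical// => -[xc x2].
  have Dx : hypitv alpha beta x by apply/hypitvP; rewrite xc.
  by split=> // /(hyp_continuous_at_split FE1 FE2 Dx)[+ _]; rewrite xc.
- rewrite /seg2 hypsegment_horizontal// => -[xc x1].
  have Dx : hypitv alpha beta x by apply/hypitvP; rewrite xc.
  by split=> // /(hyp_continuous_at_split FE1 FE2 Dx)[_ +]; rewrite xc.
Qed.
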